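(* For an $M\times K$ cloud and cache-aided F-RAN with fractional cache size $\mu\in[0,1]$ and fronthaul rate $r\ge0$, the minimum NDT $\delta^*_{\mathsf P}(\mu,r)$ under pipelined fronthaul-edge transmission and the minimum NDT $\delta^*(\mu,r)$ under serial fronthaul-edge transmission satisfy $$\delta^*_{\mathsf P}(\mu,r)\ \ge\ \frac{\delta^*(\mu,r)}{2}.$$
   Context: F-RAN model (serial transmission). $M$ edge nodes (ENs) serve $K$ users from a library of $N\ge K$ files $F_1,\dots,F_N$, independent and uniform on $\{1,\dots,2^L\}$. The channel $\mathbf H=(h_{km})\in\mathbb C^{K\times M}$ has entries drawn i.i.d. from a continuous distribution, is constant during a transmission interval and known to all nodes. The demand vector $\mathbf D=(d_1,\dots,d_K)\in\{1,\dots,N\}^K$ is known to the cloud and ENs. With power $P$ and fronthaul rate $r\ge0$, put $C_F=r\log P$. A policy for file size $L$ consists of: (a) caching functions $S_{m,n}=\pi^m_{c,n}(F_n)$ with entropy $H(S_{m,n})\le\mu L$ (not depending on $\mathbf D,\mathbf H$), with $S_m=(S_{m,1},\dots,S_{m,N})$; (b) fronthaul messages $\mathbf U_m^{T_F}=\pi_f^m(F_1,\dots,F_N,S_m,\mathbf D,\mathbf H)$ of at most $T_FC_F$ bits; (c) edge codewords $\mathbf X_m^{T_E}=\pi_e^m(S_m,\mathbf U_m^{T_F},\mathbf D,\mathbf H)\in\mathbb C^{T_E}$ with average power at most $P$; (d) decoders $\widehat F_{d_k}=\pi_d^k(\mathbf Y_k^{T_E},d_k,\mathbf H)$, where $\mathbf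 Y_k^{T_E}=\sum_{m=1}^M h_{km}\mathbf X_m^{T_E}+\mathbf n_k^{T_E}$ and the noise entries are i.i.d. $\mathcal{CN}(0,1)$ over time and users. The error probability is $P_e=\max_{\mathbf D}\max_k\mathbb P(\widehat F_{d_k}\ne F_{d_k})$. A sequence of policies indexed by $L$ is feasible if, for almost all $\mathbf H$, $P_e\to0$ as $L\to\infty$. A delivery time per bit $\Delta(\mu,C_F,P)$ is achievable if some sequence of feasible policies has $\Delta(\mu,C_F,P)=\limsup_{L\to\infty}(T_F+T_E)/L$. The corresponding (achievable) normalized delivery time is $\delta(\mu,r)=\lim_{P\to\infty}\Delta(\mu,r\log P,P)\,\log P$. The minimum NDT $\delta^*(\mu,r)$ is the infimum of all achievable $\delta(\mu,r)$ ($+\infty$ if there is none). Pipelined transmission. Same model, except that fronthaul and edge transmission take place simultaneously over $T$ symbols: the fronthaul message to EN $m$ is a sequence $U_m[1],\dots,U_m[T]$, a function of $(F_1,\dots,F_N,S_m,\mathbf D,\mathbf H)$, sent over a link of capacity $C_F$ bits per symbol, and EN $m$ transmits at each time $t\in\{1,\dots,T\}$ the symbol $X_m[t]=\pi^m_{\mathsf P,e}(S_m,U_m[1],\dots,U_m[t-1],\mathbf D,\mathbf H)$; users decode from the $T$ received symbols. Feasibility is as before, the achievable NDT is $\delta_{\mathsf P}(\mu,r)=\lim_{P\to\infty}\limsup_{L\to\infty}\frac{T}{L/\log P}$, and $\delta^*_{\mathsf P}(\mu,r)$ is the infimum of all achievable $\delta_{\mathsf P}(\mu,r)$. *)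

(* Defs.v *)
From HB Require Import structures.
From mathcomp Require Import all_boot all_order all_algebra.
From mathcomp Require Import complex.
From mathcomp Require Import all_classical all_reals all_analysis.

Set Implicit Arguments.
Unset Strict Implicit.
Unset Printing Implicit Defensive.

Import Order.TTheory GRing.Theory Num.Theory.
Import numFieldNormedType.Exports.

Local Open Scope classical_set_scope.
Local Open Scope ring_scope.
Local Open Scope complex_scope.

Definition log2 (R : realType) (x : R) : R := ln x / ln 2.

(* R[i] carries the Borel sigma-algebra of the plane, transported from R * R. *)
Definition complex_pair (R : realType) (z : R[i]) : R * R :=
  (complex.Re z, complex.Im z).

Definition complex_borel (R : realType) : set_system R[i] :=
  preimage_set_system setT (@complex_pair R) measurable.

Lemma complex_borel_sigma_algebra (R : realType) :
  sigma_algebra setT (@complex_borel R).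
Proof. exact/sigma_algebra_preimage/sigma_algebra_measurable. Qed.

Lemma complex_borel0 (R : realType) : @complex_borel R set0.
Proof. by case: (complex_borel_sigma_algebra R). Qed.

Lemma complex_borelC (R : realType) (A : set R[i]) :
  complex_borel A -> complex_borel (~` A).
Proof.
by case: (complex_borel_sigma_algebra R) => _ + _ mA => /(_ _ mA); rewrite setTD.
Qed.

Lemma complex_borel_bigcup (R : realType) (A : (set R[i])^nat) :
  (forall i, complex_borel (A i)) -> complex_borel (\bigcup_i A i).
Proof. by case: (complex_borel_sigma_algebra R) => _ _; apply. Qed.

HB.instance Definition _ (R : realType) := isPointed.Build (complex R) 0.

HB.instance Definition _ (R : realType) :=
  @isMeasurable.Build default_measure_display (complex R) (@complex_borel R)
    (@complex_borel0 R) (@complex_borelC R) (@complex_borel_bigcup R).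

(* CN(0,1): independent real and imaginary parts, each of variance 1/2
   (normal_prob takes the standard deviation). *)
Definition complex_normal (R : realType) : set R[i] -> \bar R :=
  let g : probability (measurableTypeR R) R :=
    normal_prob (0 : R) (Num.sqrt (2^-1)) in
  pushforward (g \x g)%E (fun xy => (xy.1 +i* xy.2 : R[i])).

Definition mutually_independent d (T : measurableType d) (R : realType)
    (P : probability T R) (I : eqType) (E : I -> set_system T) : Prop :=
  forall (J : seq I) (A : I -> set T), uniq J ->
    (forall i, i \in J -> E i (A i)) ->
    fine (P (\big[setI/setT]_(i <- J) A i)) = \prod_(i <- J) fine (P (A i)).

(* Entropy in bits; ln 0 = 0 in the library, so null atoms contribute 0. *)
Definition entropy d (T : measurableType d) (R : realType)
    (P : probability T R) (A : finType) (X : T -> A) : R :=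
  - \sum_(a : A) (fine (P (X @^-1` [set a])) *
                  log2 (fine (P (X @^-1` [set a])))).

Notation files N L := {ffun 'I_N -> 'I_(2 ^ L)%N}.
Notation demand K N := {ffun 'I_K -> 'I_N}.
Notation channel R K M := 'M[R[i]]_(K, M).

(* The randomness of an M x K F-RAN with N files.  For every file size L, the
   files of size L, the channel gains and the noise samples are independent;
   nothing is assumed about the joint law of files of different sizes.
   A continuous channel distribution is one without atoms. *)
Record fran (R : realType) (M K N : nat) := Fran {
  fran_display : measure_display;
  fran_space : measurableType fran_display;
  fran_prob : probability fran_space R;
  file : forall L : nat, 'I_N -> fran_space -> 'I_(2 ^ L)%N;
  gain : 'I_K -> 'I_M -> {RV fran_prob >-> R[i]};
  noise : 'I_K -> nat -> {RV fran_prob >-> R[i]};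
  gain_law : probability R[i] R;
  gain_law_continuous : forall c : R[i], gain_law [set c] = 0%E;
  gain_identically_distributed : forall k m (B : set R[i]), measurable B ->
    fran_prob (gain k m @^-1` B) = gain_law B;
  noise_complex_normal : forall k t (B : set R[i]), measurable B ->
    fran_prob (noise k t @^-1` B) = complex_normal B;
  file_measurable : forall L n (f : 'I_(2 ^ L)%N),
    measurable (file L n @^-1` [set f]);
  file_uniform : forall L n (f : 'I_(2 ^ L)%N),
    fran_prob (file L n @^-1` [set f]) = ((2 ^+ L)^-1 : R)%:E;
  fran_independent : forall L : nat,
    mutually_independent fran_prob
      (fun i : 'I_K * 'I_M + 'I_K * nat + 'I_N =>
         match i with
         | inl (inl (k, m)) => preimage_set_system setT (gain k m) measurable
         | inl (inr (k, t)) => preimage_set_system setT (noise k t) measurable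
         | inr n => preimage_set_system setT (file L n) setT
         end) }.

Arguments file {R M K N} X L n _ : rename.
Arguments gain {R M K N} X k m : rename.
Arguments noise {R M K N} X k t : rename.

Definition channel_of (R : realType) (M K N : nat) (X : fran R M K N)
    (w : fran_space X) : channel R K M := \matrix_(k, m) gain X k m w.

Definition files_of (R : realType) (M K N : nat) (X : fran R M K N) (L : nat)
    (w : fran_space X) : files N L := [ffun n => file X L n w].

Record serial_policy (R : realType) (M K N L : nat) := SerialPolicy {
  fronthaul_time : nat;
  edge_time : nat;
  s_content : finType;
  s_message : finType;
  s_cache : 'I_M -> 'I_N -> 'I_(2 ^ L)%N -> s_content;
  s_fronthaul : 'I_M -> files N L -> {ffun 'I_N -> s_content} -> demand K N ->
    channel R K M -> s_message;
  s_encode : 'I_M -> {ffun 'I_N -> s_content} -> s_message -> demand K N ->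
    channel R K M -> edge_time.-tuple R[i];
  s_decode : 'I_K -> edge_time.-tuple R[i] -> 'I_N -> channel R K M ->
    'I_(2 ^ L)%N }.

(* The encoder of symbol t (counted from 0) receives the list of fronthaul
   symbols of the earlier instants only; see pipelined_codeword. *)
Record pipelined_policy (R : realType) (M K N L : nat) := PipelinedPolicy {
  total_time : nat;
  p_content : finType;
  p_symbol : finType;
  p_cache : 'I_M -> 'I_N -> 'I_(2 ^ L)%N -> p_content;
  p_fronthaul : 'I_M -> files N L -> {ffun 'I_N -> p_content} -> demand K N ->
    channel R K M -> total_time.-tuple p_symbol;
  p_encode : 'I_M -> 'I_total_time -> {ffun 'I_N -> p_content} ->
    seq p_symbol -> demand K N -> channel R K M -> R[i];
  p_decode : 'I_K -> total_time.-tuple R[i] -> 'I_N -> channel R K M ->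
    'I_(2 ^ L)%N }.

Arguments s_fronthaul {R M K N L} p m _ _ _ _ : rename.
Arguments s_encode {R M K N L} p m _ _ _ _ : rename.
Arguments s_decode {R M K N L} p k _ _ _ : rename.
Arguments p_fronthaul {R M K N L} p m _ _ _ _ : rename.
Arguments p_encode {R M K N L} p m t _ _ _ _ : rename.
Arguments p_decode {R M K N L} p k _ _ _ : rename.

Definition cached (M N L : nat) (C : finType)
    (c : 'I_M -> 'I_N -> 'I_(2 ^ L)%N -> C) (m : 'I_M) (F : files N L) :
  {ffun 'I_N -> C} := [ffun n => c m n (F n)].

Definition serial_codeword (R : realType) (M K N L : nat)
    (p : serial_policy R M K N L) (F : files N L) (D : demand K N)
    (H : channel R K M) (m : 'I_M) : (edge_time p).-tuple R[i] :=
  let S := cached (s_cache p) m F in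
  s_encode p m S (s_fronthaul p m F S D H) D H.

Definition pipelined_codeword (R : realType) (M K N L : nat)
    (p : pipelined_policy R M K N L) (F : files N L) (D : demand K N)
    (H : channel R K M) (m : 'I_M) : (total_time p).-tuple R[i] :=
  let S := cached (p_cache p) m F in
  let U := p_fronthaul p m F S D H in
  [tuple p_encode p m t S (take t U) D H | t < total_time p].

Definition cache_constraint (R : realType) (M K N : nat) (X : fran R M K N)
    (mu : R) (L : nat) (C : finType)
    (c : 'I_M -> 'I_N -> 'I_(2 ^ L)%N -> C) : Prop :=
  forall m n, entropy (fran_prob X) (c m n \o file X L n) <= mu * L%:R.

Definition power_constraint (R : realType) (M K N L : nat) (P : R) (T : nat)
    (x : files N L -> demand K N -> channel R K M -> 'I_M -> T.-tuple R[i]) :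
  Prop :=
  forall F D H m,
    \sum_(t < T) (complex.Re (tnth (x F D H m) t) ^+ 2 +
                  complex.Im (tnth (x F D H m) t) ^+ 2) <= T%:R * P.

Definition decoder_measurable (R : realType) (M K N L : nat) (T : nat)
    (dec : 'I_K -> T.-tuple R[i] -> 'I_N -> channel R K M -> 'I_(2 ^ L)%N) :
  Prop :=
  forall k n H f, measurable [set y | dec k y n H = f].

Definition received (R : realType) (M K N : nat) (X : fran R M K N) (T : nat)
    (H : channel R K M) (x : 'I_M -> T.-tuple R[i]) (k : 'I_K)
    (w : fran_space X) : T.-tuple R[i] :=
  [tuple \sum_(m < M) H k m * tnth (x m) t + noise X k t w | t < T].

(* The error probability at a fixed channel realization H, over the files and
   the noise. *)
Definition error_prob (R : realType) (M K N : nat) (X : fran R M K N)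
    (L T : nat)
    (x : files N L -> demand K N -> channel R K M -> 'I_M -> T.-tuple R[i])
    (dec : 'I_K -> T.-tuple R[i] -> 'I_N -> channel R K M -> 'I_(2 ^ L)%N)
    (H : channel R K M) : R :=
  \big[Num.max/0]_(D : demand K N) \big[Num.max/0]_(k < K)
    fine (fran_prob X [set w |
      dec k (received H (x (files_of L w) D H) k w) (D k) H
        <> files_of L w (D k)]).

(* CF is the fronthaul capacity in bits per symbol. *)
Definition serial_admissible (R : realType) (M K N : nat) (X : fran R M K N)
    (mu CF P : R) (L : nat) (p : serial_policy R M K N L) : Prop :=
  [/\ cache_constraint X mu (s_cache p),
      log2 (#|s_message p|%:R : R) <= (fronthaul_time p)%:R * CF,
      power_constraint P (serial_codeword p) &
      decoder_measurable (s_decode p)].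

Definition pipelined_admissible (R : realType) (M K N : nat)
    (X : fran R M K N) (mu CF P : R) (L : nat)
    (p : pipelined_policy R M K N L) : Prop :=
  [/\ cache_constraint X mu (p_cache p),
      log2 (#|p_symbol p|%:R : R) <= CF,
      power_constraint P (pipelined_codeword p) &
      decoder_measurable (p_decode p)].

Definition serial_feasible (R : realType) (M K N : nat) (X : fran R M K N)
    (mu CF P : R) (p : forall L, serial_policy R M K N L) : Prop :=
  (forall L, serial_admissible X mu CF P (p L)) /\
  {ae fran_prob X, forall w,
    error_prob X (serial_codeword (p L)) (s_decode (p L))
      (channel_of w) @[L --> \oo] --> (0 : R)}.

Definition pipelined_feasible (R : realType) (M K N : nat) (X : fran R M K N)
    (mu CF P : R) (p : forall L, pipelined_policy R M K N L) : Prop :=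
  (forall L, pipelined_admissible X mu CF P (p L)) /\
  {ae fran_prob X, forall w,
    error_prob X (pipelined_codeword (p L)) (p_decode (p L))
      (channel_of w) @[L --> \oo] --> (0 : R)}.

Definition serial_achievable_time (R : realType) (M K N : nat)
    (X : fran R M K N) (mu CF P Delta : R) : Prop :=
  exists2 p : forall L, serial_policy R M K N L,
    serial_feasible X mu CF P p &
    limn_esup (fun L : nat =>
      ((fronthaul_time (p L) + edge_time (p L))%:R / L%:R : R)%:E) = Delta%:E.

(* Only large powers matter: log2 P may fail to be positive for small P. *)
Definition serial_achievable_NDT (R : realType) (M K N : nat)
    (X : fran R M K N) (mu r delta : R) : Prop :=
  exists2 Delta : R -> R,
    (\forall P \near +oo,
       serial_achievable_time X mu (r * log2 P) P (Delta P)) &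
    Delta P * log2 P @[P --> +oo] --> delta.

Definition pipelined_achievable_NDT (R : realType) (M K N : nat)
    (X : fran R M K N) (mu r delta : R) : Prop :=
  exists2 delta_ : R -> R,
    (\forall P \near +oo,
       exists2 p : forall L, pipelined_policy R M K N L,
         pipelined_feasible X mu (r * log2 P) P p &
         limn_esup (fun L : nat =>
           ((total_time (p L))%:R / (L%:R / log2 P) : R)%:E) =
         (delta_ P)%:E) &
    delta_ P @[P --> +oo] --> delta.

(* ereal_inf set0 = +oo *)
Definition serial_min_NDT (R : realType) (M K N : nat) (X : fran R M K N)
    (mu r : R) : \bar R :=
  ereal_inf [set delta%:E | delta in serial_achievable_NDT X mu r].

Definition pipelined_min_NDT (R : realType) (M K N : nat) (X : fran R M K N)
    (mu r : R) : \bar R :=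
  ereal_inf [set delta%:E | delta in pipelined_achievable_NDT X mu r].

(* Main.v *)
Require Import Defs.
From HB Require Import structures.
From mathcomp Require Import all_boot all_order all_algebra.
From mathcomp Require Import complex.
From mathcomp Require Import all_classical all_reals all_analysis.

(** A pipelined policy of duration [T] is simulated serially: the whole sequence
    of [T] fronthaul symbols is delivered first, in [T] channel uses, and then
    each EN transmits its pipelined codeword in another [T] uses.  Caches,
    codewords and decoders are unchanged, so the error probability and the power
    are the same, while the delivery time exactly doubles. *)

Import Order.TTheory GRing.Theory Num.Theory.
Import numFieldNormedType.Exports.

Local Open Scope classical_set_scope.
Local Open Scope ring_scope.

Lemma ereal_inf_pZl (R : realType) (S : set (\bar R)) (c : R) : 0 < c ->
  (ereal_inf [set c%:E * x | x in S] = c%:E * ereal_inf S)%E.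
Proof.
move=> c0; rewrite /ereal_inf muleN -ereal_sup_pZl//; congr (- ereal_sup _)%E.
by rewrite -!image_comp/= !image_comp; apply: eq_imagel => x _ /=; rewrite muleN.
Qed.

(** [limn_esup] is an infimum of suprema, and a positive finite factor passes through both, even at
    infinite values. *)
Lemma limn_esup_pZl (R : realType) (u : (\bar R)^nat) (c : R) : 0 < c ->
  (limn_esup (fun n => c%:E * u n) = c%:E * limn_esup u)%E.
Proof.
move=> c0; rewrite /limn_esup /limf_esup -ereal_inf_pZl// image_comp.
congr ereal_inf; apply: eq_imagel => V _ /=.
by rewrite -ereal_sup_pZl// image_comp.
Qed.

Lemma log2_gt0 (R : realType) (x : R) : 1 < x -> 0 < log2 x.
Proof. by move=> x1; rewrite divr_gt0 ?ln_gt0// ltr1n. Qed.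

(* Also valid at x = 0, as ln 0 = 0. *)
Lemma log2Xn (R : realType) (x : R) (n : nat) : 0 <= x ->
  log2 (x ^+ n) = n%:R * log2 x.
Proof.
rewrite /log2 le_eqVlt => /predU1P[<-|x0]; last first.
  by rewrite lnXn// mulr_natl mulrnAl.
by rewrite expr0n; case: n => [|n]; rewrite ?ln1 ?(ln0 (lexx 0)) !mul0r ?mulr0.
Qed.

(** A message is the whole symbol tuple, yet the encoder still reads only [take t U]: the codeword
    is unchanged by computation, so the power and error conditions carry over as they stand. *)
Definition serialize {R : realType} {M K N L : nat}
    (p : pipelined_policy R M K N L) : serial_policy R M K N L :=
  SerialPolicy (total_time p) (s_message := (total_time p).-tuple (p_symbol p))
    (p_cache p) (p_fronthaul p)
    (fun m S U D H => [tuple p_encode p m t S (take t U) D H | t < total_time p])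
    (p_decode p).

Lemma serialize_admissible (R : realType) (M K N L : nat) (X : fran R M K N)
    (mu CF P : R) (p : pipelined_policy R M K N L) :
  pipelined_admissible X mu CF P p ->
  serial_admissible X mu CF P (serialize p).
Proof.
case=> cacheP linkP powerP decP; split=> //=.
(* The message alphabet has size [#|p_symbol p| ^ total_time p]; an empty symbol alphabet is
   covered, as [log2Xn] allows 0. *)
by rewrite card_tuple natrX log2Xn// ler_wpM2l.
Qed.

Lemma serialize_feasible (R : realType) (M K N : nat) (X : fran R M K N)
    (mu CF P : R) (p : forall L, pipelined_policy R M K N L) :
  pipelined_feasible X mu CF P p ->
  serial_feasible X mu CF P (fun L => serialize (p L)).
Proof. by case=> admP errP; split=> // L; exact: serialize_admissible. Qed.

Lemma pipelined_achievable_NDT_serial (R : realType) (M K N : nat)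
    (X : fran R M K N) (mu r delta : R) :
  pipelined_achievable_NDT X mu r delta ->
  serial_achievable_NDT X mu r (2 * delta).
Proof.
case=> d achP cvgd.
have logP : \forall P \near +oo, 0 < log2 (P : R).
  by near=> P; apply: log2_gt0; near: P; exact: nbhs_pinfty_gt.
(* [d P] is already normalized by [log2 P], whereas a serial delivery time is per bit; the 2 counts
   the two phases. *)
exists (fun P => 2 / log2 P * d P).
  near=> P.
  have P0 : 0 < log2 P by near: P.
  have [p feasP limP] : exists2 p : forall L, pipelined_policy R M K N L,
      pipelined_feasible X mu (r * log2 P) P p &
      limn_esup (fun L : nat =>
        ((total_time (p L))%:R / (L%:R / log2 P) : R)%:E) = (d P)%:E.
    by near: P.
  exists (fun L => serialize (p L)); first exact: serialize_feasible.
  rewrite EFinM -limP -limn_esup_pZl; last exact: divr_gt0.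
  congr limn_esup; apply/funext => L /=; rewrite -EFinM; congr (_%:E).
  (* Termwise, 2T/L = (2/l)(T/(L/l)). Only [l] is cancelled, so [L = 0] needs no separate case. *)
  rewrite addnn -mul2n natrM; move: (log2 P) P0 => l l0.
  by rewrite invfM invrK (mulrA (_ %:R) (_^-1) l) mulrACA mulVf ?gt_eqF//
    mulr1 mulrA.
(* The factor [log2 P] cancels only where it is nonzero, hence the passage through equality near
   +oo. *)
have : 2 * d P @[P --> +oo] --> 2 * delta by exact: cvgMl_tmp.
apply: cvg_trans; apply: near_eq_cvg.
by near=> P; rewrite mulrAC divfK// gt_eqF//; near: P.
Unshelve. all: by end_near. Qed.

Theorem lemma4 (R : realType) (M K N : nat) (hKN : (K <= N)%N)
    (X : fran R M K N) (mu r : R) (hmu : 0 <= mu <= 1) (hr : 0 <= r) :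
  (serial_min_NDT X mu r / 2%:E <= pipelined_min_NDT X mu r)%E.
Proof.
(* Each achievable pipelined [delta] is bounded separately; if there is none, the right side is
   +oo. *)
apply: le_ereal_inf_tmp => _ [delta achP <-].
rewrite inver pnatr_eq0/= lee_pdivrMr// -EFinM mulrC.
by apply: ereal_inf_lbound; exists (2 * delta) => //;
  exact: pipelined_achievable_NDT_serial.
Qed.
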